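(* For every $\varepsilon>0$ and integer $k \ge 2$ there is an $\eta>0$ such that for all sufficiently large $n$ the following holds: if $\mathcal{F}$ is a family of subsets of $[n]$ of size $m := |\mathcal{F}| \ge (1-\eta)k2^{n/k}$ with $\operatorname{dp}(\mathcal{F}) \ge (1-\frac{1}{k}-\eta)\frac{m^2}{2}$, then $k$ divides $n$ and there is a balanced series of $k$ cubes over $[n]$ that contains all but at most $\varepsilon m$ members of $\mathcal{F}$.
   Context: For a family $\mathcal{G}$ of subsets of $[n]=\{1,\ldots,n\}$, $\operatorname{dp}(\mathcal{G})$ is the number of unordered pairs $\{A,B\}$ with $A,B\in\mathcal{G}$ and $A\cap B=\emptyset$ (where $A=B=\emptyset$ is allowed and counted as one pair). A balanced series of $k$ cubes over $[n]$ is a family $\bigcup_{i=1}^k \{A : A \subseteq S_i\}$ where $S_1,\ldots,S_k$ is a partition of $[n]$ with $\lfloor n/k\rfloor \le |S_i| \le \lceil n/k\rceil$ for each $i$. *)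

(* Defs.v *)
From mathcomp Require Import all_boot.
From Stdlib Require Import Reals.
Set Implicit Arguments. Unset Strict Implicit. Unset Printing Implicit Defensive.

(* dp G: number of unordered pairs {A,B} (as the finite set [set A; B]) with
   A, B in G and A, B disjoint.  {A,A} only occurs for A = set0. *)
Definition dp (n : nat) (G : {set {set 'I_n}}) : nat :=
  #|[set P : {set {set 'I_n}} |
      [exists A in G, exists B in G, [disjoint A & B] && (P == [set A; B])]]|.

Definition balanced_partition (n k : nat) (S : 'I_k -> {set 'I_n}) : Prop :=
  (forall i j : 'I_k, i != j -> [disjoint S i & S j]) /\
  (\bigcup_(i < k) S i = [set: 'I_n]) /\
  (forall i : 'I_k, n %/ k <= #|S i| <= (n + k - 1) %/ k).

Definition cube_series (n k : nat) (S : 'I_k -> {set 'I_n}) : {set {set 'I_n}} :=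
  \bigcup_(i < k) powerset (S i).

(* Main.v *)
(* Let m = |F| and call two members of F adjacent when they are disjoint.

   Few (k+1)-cliques.  If a positive proportion of the (k+1)-tuples of F were
   pairwise disjoint, convexity would allow one coordinate after another to be
   replaced by the union of t members of F.  As m >= 2^(n/k), for
   t = 2k(k+1) almost all such unions have more than n/(k+1) elements, so k+1 of
   them cannot be disjoint.

   Partition.  The Moon-Moser inequalities give many k-cliques x, and an averaging
   argument gives one for which the common neighbourhoods of the k subcliques of
   size k-1, minus that of x, form disjoint sets Q_i that cover almost all of F and
   have few edges inside.  Comparing edge counts, |Q_i| is about m/k and almost all
   pairs between different Q_i are disjoint.

   Cubes.  Let S_i be the set of elements lying in a positive proportion of Q_i.
   The S_i are disjoint, and almost every member of Q_i avoids the other S_j.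
   Elements of the rest Z are rare in every Q_i, so an entropy-type bound gives
   |Q_i| <= (1 + o(1)) 2^|S_i| c^|Z| with c^k <= 3/2.  Multiplying over i,
   (7/8) 2^n <= 2^(n - |Z|) (3/2)^|Z|, whence Z is empty; then
   |Q_i| <= (1 + o(1)) 2^|S_i| forces k |S_i| = n for every i. *)

Require Import Defs.
From mathcomp Require Import all_boot all_order all_algebra.
From mathcomp Require Import ring lra zify.
From mathcomp Require Import reals sequences exp.
Set Implicit Arguments. Unset Strict Implicit. Unset Printing Implicit Defensive.
Import Order.TTheory GRing.Theory Num.Theory.

Definition pairwise_disjoint (V I : finType) (Q : I -> {set V}) : Prop :=
  forall i j, i != j -> [disjoint Q i & Q j].

Lemma card_bigcup_disjoint (V I : finType) (Q : I -> {set V}) :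
  pairwise_disjoint Q -> #|\bigcup_i Q i| = \sum_i #|Q i|.
Proof.
move=> Qdis; rewrite -sum1_card partition_disjoint_bigcup //.
by apply: eq_bigr => i _; rewrite sum1_card.
Qed.

Section FfunInsertion.
Variable V : finType.

Definition ffun_del r (i : 'I_r.+1) (x : {ffun 'I_r.+1 -> V}) : {ffun 'I_r -> V} :=
  [ffun j => x (lift i j)].

Definition ffun_ins r (i : 'I_r.+1) (v : V) (y : {ffun 'I_r -> V}) :
    {ffun 'I_r.+1 -> V} :=
  [ffun j => if unlift i j is Some j' then y j' else v].

Lemma ffun_ins_lift r (i : 'I_r.+1) v y j : ffun_ins i v y (lift i j) = y j.
Proof. by rewrite ffunE liftK. Qed.

Lemma ffun_ins_id r (i : 'I_r.+1) v y : ffun_ins i v y i = v.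
Proof. by rewrite ffunE unlift_none. Qed.

Lemma ffun_ins_del r (i : 'I_r.+1) (x : {ffun 'I_r.+1 -> V}) :
  ffun_ins i (x i) (ffun_del i x) = x.
Proof.
apply/ffunP => j; case: (unliftP i j) => [j'|] ->; last by rewrite ffun_ins_id.
by rewrite ffun_ins_lift ffunE.
Qed.

Lemma ffun_del_ins r (i : 'I_r.+1) v y : ffun_del i (ffun_ins i v y) = y.
Proof. by apply/ffunP => j; rewrite ffunE ffun_ins_lift. Qed.

Lemma forall_ord_lift r (i : 'I_r.+1) (P : pred 'I_r.+1) :
  [forall j, P j] = P i && [forall j, P (lift i j)].
Proof.
apply/forallP/andP => [Pj|[Pi /forallP Pl] j]; first by split=> //; apply/forallP.
by case: (unliftP i j) => [j'|] ->.
Qed.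

Lemma forall_ffun_ins r (i : 'I_r.+1) (P : pred V) v y :
  [forall j, P (ffun_ins i v y j)] = P v && [forall j, P (y j)].
Proof.
rewrite (forall_ord_lift i) ffun_ins_id; congr (_ && _).
by apply: eq_forallb => j; rewrite ffun_ins_lift.
Qed.

Lemma big_ffun_ins (A : Type) (idx : A) (op : Monoid.com_law idx) r (i : 'I_r.+1)
    (P : pred {ffun 'I_r.+1 -> V}) (F : {ffun 'I_r.+1 -> V} -> A) :
  \big[op/idx]_(x | P x) F x =
  \big[op/idx]_y \big[op/idx]_(v | P (ffun_ins i v y)) F (ffun_ins i v y).
Proof.
rewrite pair_big_dep /= (reindex (fun p => ffun_ins i p.2 p.1)) //=.
exists (fun x => (ffun_del i x, x i)) => [[y v] _|x _] /=.
  by rewrite ffun_del_ins ffun_ins_id.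
by rewrite ffun_ins_del.
Qed.

End FfunInsertion.

(** * Cliques in a finite graph *)

Section Cliques.
Variables (V : finType) (e : rel V).

Definition cliques r : {set {ffun 'I_r -> V}} :=
  [set x : {ffun 'I_r -> V} | [forall i, forall j, (i != j) ==> e (x i) (x j)]].

Definition common_nbrs r (y : {ffun 'I_r -> V}) : {set V} :=
  [set v | [forall i, e v (y i)]].

Definition facet_nbrs r (i : 'I_r.+1) (x : {ffun 'I_r.+1 -> V}) : {set V} :=
  common_nbrs (ffun_del i x).

Definition arcs (A B : {set V}) : nat := \sum_(a in A) \sum_(b in B) e a b.

Definition facet_arcs r (x : {ffun 'I_r.+1 -> V}) : nat :=
  \sum_i arcs (facet_nbrs i x) (facet_nbrs i x).

Lemma common_nbrs0 (y : {ffun 'I_0 -> V}) : common_nbrs y = setT.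
Proof. by apply/setP => v; rewrite !inE; apply/forallP => -[]. Qed.

Lemma common_nbrs_ins r (i : 'I_r.+1) v y w :
  (w \in common_nbrs (ffun_ins i v y)) = e w v && (w \in common_nbrs y).
Proof. by rewrite !inE (forall_ffun_ins i (e w)). Qed.

Lemma common_nbrs_facet r (i : 'I_r.+1) (x : {ffun 'I_r.+1 -> V}) v :
  (v \in common_nbrs x) = e v (x i) && (v \in facet_nbrs i x).
Proof. by rewrite -(common_nbrs_ins i) ffun_ins_del. Qed.

Lemma card_cliques0 : #|cliques 0| = 1.
Proof.
rewrite (_ : cliques 0 = setT); first by rewrite cardsT card_ffun card_ord.
by apply/setP => x; rewrite !inE; apply/forallP => -[].
Qed.

Lemma arcs_subset (A B C D : {set V}) :
  A \subset C -> B \subset D -> arcs A B <= arcs C D.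
Proof.
move=> sAC sBD; rewrite /arcs [leqRHS](big_setID A) (setIidPr sAC) /=.
apply: leq_trans (leq_addr _ _); apply: leq_sum => a _.
by rewrite [leqRHS](big_setID B) (setIidPr sBD) /= leq_addr.
Qed.

Lemma arcs_le_cards (A B : {set V}) : arcs A B <= #|A| * #|B|.
Proof.
rewrite -sum_nat_const; apply: leq_sum => a _.
by rewrite -sum1_card; apply: leq_sum => b _; exact: leq_b1.
Qed.

Lemma arcs_bigcup (I : finType) (Q : I -> {set V}) :
  pairwise_disjoint Q ->
  arcs (\bigcup_i Q i) (\bigcup_i Q i) = \sum_i \sum_j arcs (Q i) (Q j).
Proof.
move=> Qdis; rewrite /arcs partition_disjoint_bigcup //.
apply: eq_bigr => i _; rewrite [RHS]exchange_big /=.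
by apply: eq_bigr => a _; rewrite partition_disjoint_bigcup.
Qed.

Lemma arcs_setT_le (C : {set V}) :
  arcs setT setT <= arcs C C + 2 * (#|~: C| * #|V|).
Proof.
rewrite /arcs [leqLHS](big_setID C) setTI setTD /= mul2n -addnn addnA.
apply: leq_add; last first.
  by apply: leq_trans (arcs_le_cards _ _) _; rewrite cardsT.
under eq_bigr do rewrite (big_setID C) setTI setTD.
rewrite big_split leq_add2l /= mulnC.
by apply: leq_trans (arcs_le_cards _ _) _; rewrite leq_mul2r max_card orbT.
Qed.

Hypothesis e_sym : symmetric e.

Lemma mem_cliques_ins r (i : 'I_r.+1) v y :
  (ffun_ins i v y \in cliques r.+1) = (y \in cliques r) && (v \in common_nbrs y).
Proof.
rewrite !inE (forall_ord_lift i) ffun_ins_id.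
rewrite (forall_ord_lift i) eqxx /= andbC.
apply/andP/andP => -[/forallP cl /forallP vN].
  split; apply/forallP => j; last by have := vN j; rewrite neq_lift ffun_ins_lift.
  apply/forallP => l; have := forallP (cl j) (lift i l).
  by rewrite !ffun_ins_lift (inj_eq lift_inj).
split; apply/forallP => j; last by rewrite ffun_ins_lift vN implybT.
rewrite (forall_ord_lift i) ffun_ins_id ffun_ins_lift e_sym vN implybT.
apply/forallP => l; rewrite ffun_ins_lift (inj_eq lift_inj).
exact: (forallP (cl j)).
Qed.

Lemma big_cliquesS (A : Type) (idx : A) (op : Monoid.com_law idx) r (i : 'I_r.+1)
    (F : {ffun 'I_r.+1 -> V} -> A) :
  \big[op/idx]_(x in cliques r.+1) F x =
  \big[op/idx]_(y in cliques r) \big[op/idx]_(v in common_nbrs y) F (ffun_ins i v y).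
Proof.
rewrite (big_ffun_ins _ i) [RHS]big_mkcond; apply: eq_bigr => y _.
under eq_bigl do rewrite mem_cliques_ins.
by case: (y \in _) => //=; rewrite big_pred0.
Qed.

Lemma card_cliquesS r : #|cliques r.+1| = \sum_(y in cliques r) #|common_nbrs y|.
Proof.
rewrite -sum1_card (big_cliquesS _ ord0).
by apply: eq_bigr => y _; rewrite sum1_card.
Qed.

Lemma card_cliques1 : #|cliques 1| = #|V|.
Proof.
rewrite card_cliquesS; under eq_bigr do rewrite common_nbrs0 cardsT.
by rewrite sum_nat_const card_cliques0 mul1n.
Qed.

Lemma card_cliquesSS r :
  #|cliques r.+2| = \sum_(y in cliques r) arcs (common_nbrs y) (common_nbrs y).
Proof.
rewrite card_cliquesS (big_cliquesS _ ord0); apply: eq_bigr => y _.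
apply: eq_bigr => v _; rewrite -sum1_card big_mkcond [RHS]big_mkcond /=.
apply: eq_bigr => w _; rewrite common_nbrs_ins e_sym.
by case: (e v w); case: (w \in _).
Qed.

Lemma card_cliques2 : #|cliques 2| = arcs setT setT.
Proof.
rewrite card_cliquesSS; under eq_bigr do rewrite common_nbrs0.
by rewrite sum_nat_const card_cliques0 mul1n.
Qed.

Lemma sum_facet_nbrs_le r (x : {ffun 'I_r.+1 -> V}) :
  \sum_i #|facet_nbrs i x| <= #|V| + r * #|common_nbrs x|.
Proof.
have cardE (A : {set V}) : #|A| = \sum_v (v \in A) by rewrite -sum1_card big_mkcond.
under eq_bigr do rewrite cardE.
rewrite exchange_big /= [#|common_nbrs x|]cardE big_distrr -sum1_card -big_split /=.
apply: leq_sum => v _; have [_|] := boolP (v \in common_nbrs x).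
  rewrite muln1 add1n -[X in _ <= X](card_ord r.+1) -sum1_card.
  by apply: leq_sum => i _; exact: leq_b1.
rewrite muln0 addn0 => /[!inE] /forallPn[j Nvj].
rewrite (bigD1 j) //= big1 ?addn0 ?leq_b1 // => i ij; apply/eqP; rewrite eqb0.
have [j' jE _] := unlift_some ij.
by rewrite inE; apply/forallPn; exists j'; rewrite ffunE -jE.
Qed.

Lemma sum_card_facet_nbrs r :
  \sum_(x in cliques r.+1) \sum_i #|facet_nbrs i x| =
  r.+1 * \sum_(y in cliques r) #|common_nbrs y| ^ 2.
Proof.
rewrite exchange_big -[X in X * _](card_ord r.+1) -sum_nat_const.
apply: eq_bigr => i _.
rewrite (big_cliquesS _ i); apply: eq_bigr => y _.
under eq_bigr do rewrite /facet_nbrs ffun_del_ins.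
by rewrite sum_nat_const mulnn.
Qed.

Lemma sum_facet_arcs_le r :
  \sum_(x in cliques r.+1) facet_arcs x <= r.+1 * (#|V| * #|cliques r.+2|).
Proof.
rewrite exchange_big -[X in X * _](card_ord r.+1) -sum_nat_const.
apply: leq_sum => i _.
rewrite (big_cliquesS _ i) card_cliquesSS big_distrr; apply: leq_sum => y _ /=.
under eq_bigr do rewrite /facet_nbrs ffun_del_ins.
by rewrite sum_nat_const leq_mul2r max_card orbT.
Qed.

(* Moon-Moser: double count the pairs of a clique and a vertex adjacent to all but
   at most one of its members. *)
Lemma sum_sqr_common_nbrs_le r :
  r.+1 * \sum_(y in cliques r) #|common_nbrs y| ^ 2 <=
  #|V| * #|cliques r.+1| + r * #|cliques r.+2|.
Proof.
rewrite -sum_card_facet_nbrs (card_cliquesS r.+1) -sum1_card !big_distrr -big_split.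
by apply: leq_sum => x _ /=; rewrite muln1; exact: sum_facet_nbrs_le.
Qed.

End Cliques.

Local Open Scope ring_scope.

(** * Averages of finite families *)

Lemma exists_ge_average (R : realFieldType) (I : finType) (A : {set I}) (f : I -> R) c :
  (0 < #|A|)%N -> c * #|A|%:R <= \sum_(i in A) f i -> exists2 i, i \in A & c <= f i.
Proof.
move=> A0 le_sum; apply/exists_inP; apply: contraLR le_sum => /exists_inPn lt_f.
rewrite -ltNge mulr_natr -sumr_const; apply: ltr_sum => [|i Ai].
  by have [i Ai] := card_gt0P A0; apply/hasP; exists i; rewrite ?mem_index_enum.
by rewrite ltNge lt_f.
Qed.

Lemma sum_sqr_ge_average (R : realFieldType) (I : finType) (A : {set I}) (f : I -> R) c :
  (forall i, i \in A -> 0 <= f i) -> c * #|A|%:R <= \sum_(i in A) f i ->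
  c * \sum_(i in A) f i <= \sum_(i in A) f i ^+ 2.
Proof.
move=> f0 le_sum; have sum0 : 0 <= \sum_(i in A) f i by exact: sumr_ge0.
have [c0|c0] := lerP c 0.
  by apply: le_trans (mulr_le0_ge0 c0 sum0) _; apply: sumr_ge0 => i _; exact: sqr_ge0.
have : 0 <= \sum_(i in A) (f i - c) ^+ 2 by apply: sumr_ge0 => i _; exact: sqr_ge0.
under eq_bigr do rewrite sqrrB -mulrnAr.
rewrite big_split sumrB /= sumr_const -mulr_suml -(mulr_natr (c ^+ 2)).
by have := ler_wpM2l (ltW c0) le_sum; lra.
Qed.

Lemma expr_ge_tangent (R : realFieldType) (a h : R) t : 0 <= a -> 0 <= h ->
  a ^+ t.+1 + t.+1%:R * a ^+ t * (h - a) <= h ^+ t.+1.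
Proof.
move=> a0 h0; elim: t => [|t IHt]; first by rewrite !expr1 expr0; lra.
rewrite [h ^+ _]exprS; apply: le_trans (ler_wpM2l h0 IHt).
rewrite -subr_ge0 [X in 0 <= X](_ : _ = t.+1%:R * a ^+ t * (h - a) ^+ 2).
  by rewrite mulr_ge0 ?sqr_ge0 // mulr_ge0 // exprn_ge0.
by rewrite -(natr1 t.+1) !exprS; ring.
Qed.

Lemma sum_le_of_sum_expr_le (R : realFieldType) (I : finType) (A : {set I})
    (f : I -> R) (a N : R) t :
  0 < a -> (forall i, i \in A -> 0 <= f i) -> #|A|%:R <= N ->
  \sum_(i in A) f i ^+ t.+1 <= a ^+ t.+1 * N -> \sum_(i in A) f i <= a * N.
Proof.
move=> a0 f0 AN powN; have at0 : 0 < a ^+ t by rewrite exprn_gt0.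
have : \sum_(i in A) (a ^+ t.+1 + t.+1%:R * a ^+ t * (f i - a)) <= a ^+ t.+1 * N.
  by apply: le_trans (ler_sum _ _) powN => i Ai; rewrite expr_ge_tangent ?(ltW a0) ?f0.
rewrite big_split /= sumr_const -mulr_sumr big_split /= sumrN sumr_const.
rewrite -(mulr_natr a) -mulr_natr exprS => tangent.
rewrite -subr_ge0 -(pmulr_rge0 _ (mulr_gt0 (ltr0Sn R t) at0)).
have : 0 <= t%:R * (a * a ^+ t) * (N - #|A|%:R).
  by rewrite !mulr_ge0 ?subr_ge0 // ltW.
move: tangent; rewrite -natr1; lra.
Qed.

(** * Moon-Moser inequalities and stability *)

Section MoonMoser.
Variables (R : realFieldType) (V : finType) (e : rel V).
Hypothesis e_sym : symmetric e.
Local Notation m := (#|V|%:R : R).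
Local Notation N r := (#|cliques e r|%:R : R).

Lemma sum_sqr_common_nbrs_ge r a : a * N r <= N r.+1 ->
  a * N r.+1 <= \sum_(y in cliques e r) #|common_nbrs e y|%:R ^+ 2.
Proof.
rewrite card_cliquesS // natr_sum => a_le.
by apply: sum_sqr_ge_average a_le => y _; exact: ler0n.
Qed.

Variable theta : R.
Hypothesis edge_density : (1 - theta) * m ^+ 2 <= N 2.

Lemma card_cliquesS_ge r : (1 - r%:R * theta) * m * N r <= N r.+1.
Proof.
elim: r => [|[|r] IHr]; first by rewrite card_cliques0 card_cliques1 //; lra.
  by move: edge_density; rewrite card_cliques1 // expr2 mulrA mul1r.
have moon_moser : r.+2%:R * \sum_(y in cliques e r.+1) #|common_nbrs e y|%:R ^+ 2 <=
    m * N r.+2 + r.+1%:R * N r.+3.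
  rewrite -!natrM -natrD; under eq_bigr do rewrite -natrX.
  by rewrite -natr_sum -natrM ler_nat sum_sqr_common_nbrs_le.
rewrite -(ler_pM2l (ltr0Sn R r)).
have := ler_wpM2l (ler0n R r.+2) (sum_sqr_common_nbrs_ge IHr); move: moon_moser.
rewrite -!(natr1 r.+1); lra.
Qed.

Lemma card_cliques_ge_expr r c : 0 <= theta -> 0 <= c -> c + r%:R * theta <= 1 ->
  (c * m) ^+ r.+1 <= N r.+1.
Proof.
move=> theta0 c0; elim: r => [|r IHr] c_le.
  by rewrite card_cliques1 // expr1 ler_piMl //; lra.
apply: le_trans (card_cliquesS_ge r.+1).
rewrite exprS ler_pM ?mulr_ge0 ?exprn_ge0 ?mulr_ge0 //.
  by rewrite ler_wpM2r //; lra.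
by apply: IHr; move: c_le; rewrite -natr1; lra.
Qed.

Definition dominating_clique (w : R) k (x : {ffun 'I_k.+1 -> V}) : Prop :=
  (1 - w) * m ^+ 2 + k.+1%:R * m * #|common_nbrs e x|%:R + (facet_arcs e x)%:R
  <= m * \sum_i #|facet_nbrs e i x|%:R.

(* Average over all cliques x: the sum of the #|facet_nbrs i x| is bounded below by
   convexity, and the terms in common_nbrs x and facet_arcs x are at most
   proportional to the number of cliques of size k + 2. *)
Lemma exists_dominating_clique k (delta : R) : (0 < #|cliques e k.+1|)%N ->
  2 * k.+1%:R * N k.+2 <= delta * m * N k.+1 ->
  exists x : {ffun 'I_k.+1 -> V},
    dominating_clique (1 + delta - k.+1%:R * (1 - k%:R * theta)) x.
Proof.
move=> cliques_gt0 few; pose c := k.+1%:R * (1 - k%:R * theta) - delta.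
pose excess (x : {ffun 'I_k.+1 -> V}) : R :=
  m * \sum_i #|facet_nbrs e i x|%:R - k.+1%:R * m * #|common_nbrs e x|%:R
  - (facet_arcs e x)%:R.
suff /(exists_ge_average cliques_gt0)[x _ excess_ge] :
    c * m ^+ 2 * N k.+1 <= \sum_(x in cliques e k.+1) excess x.
  by exists x; rewrite /dominating_clique; move: excess_ge; rewrite /excess /c; lra.
have facets : k.+1%:R * ((1 - k%:R * theta) * m * N k.+1) <=
    \sum_(x in cliques e k.+1) \sum_i #|facet_nbrs e i x|%:R.
  under [leRHS]eq_bigr do rewrite -natr_sum.
  rewrite -natr_sum sum_card_facet_nbrs // natrM natr_sum ler_pM2l ?ltr0Sn //.
  under [leRHS]eq_bigr do rewrite natrX.
  by apply: sum_sqr_common_nbrs_ge; exact: card_cliquesS_ge.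
have inner : \sum_(x in cliques e k.+1) (facet_arcs e x)%:R <=
    k.+1%:R * (m * N k.+2) :> R.
  by rewrite -natr_sum -!natrM ler_nat sum_facet_arcs_le.
rewrite /excess !sumrB -!mulr_sumr -(natr_sum _ _ _ (fun x => #|common_nbrs e x|)).
rewrite -card_cliquesS //.
have := ler_wpM2l (ler0n R #|V|) facets; have := ler_wpM2l (ler0n R #|V|) few.
rewrite /c; lra.
Qed.

End MoonMoser.

Section TuranPartition.
Variables (R : realFieldType) (V : finType) (e : rel V).
Local Notation m := (#|V|%:R : R).

Definition turan_partition (I : finType) (b : R) (Q : I -> {set V}) : Prop :=
  [/\ pairwise_disjoint Q,
      forall i, (#|I|%:R^-1 - b) * m <= #|Q i|%:R &
      forall i j, i != j ->
        (#|Q i| * #|Q j|)%:R - b ^+ 2 * m ^+ 2 <= (arcs e (Q i) (Q j))%:R].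

Section Deficiency.
Variables (I : finType) (Q : I -> {set V}) (eta alpha sigma : R).
Hypothesis I_gt0 : (0 < #|I|)%N.
Hypothesis Qdis : pairwise_disjoint Q.
Hypothesis edge_density : (1 - #|I|%:R^-1 - eta) * m ^+ 2 <= (arcs e setT setT)%:R.
Hypothesis few_inner : \sum_i (arcs e (Q i) (Q i))%:R <= alpha * m ^+ 2.
Hypothesis covering : (1 - sigma) * m <= \sum_i #|Q i|%:R.
Local Notation K := (#|I|%:R : R).
Local Notation q i := (#|Q i|%:R : R).
Local Notation a i j := ((arcs e (Q i) (Q j))%:R : R).

Lemma missing_arcs_ge0 i j : 0 <= q i * q j - a i j.
Proof. by rewrite subr_ge0 -natrM ler_nat arcs_le_cards. Qed.

Lemma sum_parts_le : \sum_i q i <= m.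
Proof. by rewrite -natr_sum -card_bigcup_disjoint // ler_nat max_card. Qed.

Lemma sum_arcs_parts_ge :
  (1 - K^-1 - eta) * m ^+ 2 <= \sum_i \sum_j a i j + 2 * (m - \sum_i q i) * m.
Proof.
have -> : m - \sum_i q i = #|~: \bigcup_i Q i|%:R.
  rewrite -natr_sum -card_bigcup_disjoint // -(cardsC (\bigcup_i Q i)) natrD; ring.
apply: le_trans edge_density _.
under [X in X + _]eq_bigr do rewrite -natr_sum.
rewrite -natr_sum -arcs_bigcup // -mulrA -!natrM -natrD ler_nat.
exact: arcs_setT_le.
Qed.

Lemma sum_sqr_deviation :
  \sum_i (q i - m / K) ^+ 2 =
  \sum_i q i ^+ 2 - 2 * (m / K) * \sum_i q i + m ^+ 2 / K.
Proof.
under eq_bigr do rewrite sqrrB -mulrnAr.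
rewrite big_split sumrB /= sumr_const -mulr_suml -(mulr_natr (_ ^+ 2)).
by field; rewrite pnatr_eq0 -lt0n.
Qed.

Lemma sum_missing_arcs :
  \sum_i \sum_(j | j != i) (q i * q j - a i j) =
  (\sum_i q i) ^+ 2 - \sum_i \sum_j a i j - (\sum_i q i ^+ 2 - \sum_i a i i).
Proof.
rewrite expr2 mulr_suml -!sumrB; apply: eq_bigr => i _.
rewrite mulr_sumr -sumrB [X in _ = X - _](bigD1 i) //=; ring.
Qed.

(* A graph with parts q i and no missing arc has density at most 1 - 1/K, with
   equality for equal parts, so neither term can be large. *)
Lemma deficiency_le :
  \sum_i (q i - m / K) ^+ 2 + \sum_i \sum_(j | j != i) (q i * q j - a i j) <=
  (eta + alpha + 3 * sigma) * m ^+ 2.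
Proof.
have K1 : K^-1 <= 1 by rewrite invf_le1 ?ltr0n ?ler1n.
rewrite sum_sqr_deviation sum_missing_arcs.
have s_ge0 : 0 <= \sum_i q i by exact: sumr_ge0.
have uncovered : 0 <= (m - \sum_i q i) * (2 * m * (1 - K^-1) + \sum_i q i).
  by rewrite mulr_ge0 ?subr_ge0 ?sum_parts_le // addr_ge0 // !mulr_ge0 // subr_ge0.
have := ler_wpM2r (ler0n R #|V|) covering.
have := sum_arcs_parts_ge; move: few_inner uncovered; lra.
Qed.

Lemma turan_partition_of_deficiency b : 0 <= b ->
  eta + alpha + 3 * sigma <= b ^+ 2 -> turan_partition b Q.
Proof.
move=> b0 b_ge.
have dev_ge0 i : 0 <= (q i - m / K) ^+ 2 by exact: sqr_ge0.
have miss_ge0 i : 0 <= \sum_(j | j != i) (q i * q j - a i j).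
  by apply: sumr_ge0 => j _; exact: missing_arcs_ge0.
have total : \sum_i (q i - m / K) ^+ 2 +
    \sum_i \sum_(j | j != i) (q i * q j - a i j) <= b ^+ 2 * m ^+ 2.
  by apply: le_trans deficiency_le _; rewrite ler_wpM2r ?exprn_ge0.
split=> // [i|i j ij].
  have : (q i - m / K) ^+ 2 <= (b * m) ^+ 2.
    rewrite exprMn; apply: le_trans total; rewrite (bigD1 i) //= -addrA lerDl.
    by rewrite addr_ge0 ?sumr_ge0.
  rewrite -real_normK ?num_real // ler_sqr ?nnegrE ?mulr_ge0 // ler_norml => /andP[].
  lra.
rewrite natrM lerBlDr -lerBlDl; apply: le_trans total.
rewrite [X in _ <= _ + X](bigD1 i) //= [X in _ <= _ + (X + _)](bigD1 j) 1?eq_sym //=.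
rewrite -[X in _ <= _ + X]addrA [leRHS]addrCA lerDl !addr_ge0 ?sumr_ge0 // => l _.
exact: missing_arcs_ge0.
Qed.

End Deficiency.

Definition clique_part k (x : {ffun 'I_k.+1 -> V}) (i : 'I_k.+1) : {set V} :=
  facet_nbrs e i x :\: common_nbrs e x.

Lemma disjoint_clique_part k (x : {ffun 'I_k.+1 -> V}) :
  pairwise_disjoint (clique_part x).
Proof.
move=> i j ij; apply/pred0P => v /=; apply/negP => /andP[/setDP[vi vN] /setDP[vj _]].
move: vN; rewrite (common_nbrs_facet e i) vi andbT.
move: ij; rewrite eq_sym => /unlift_some[i' -> _].
by move: vj; rewrite inE => /forallP/(_ i'); rewrite ffunE => ->.
Qed.

Lemma turan_partition_clique_part k (x : {ffun 'I_k.+1 -> V}) (eta w b : R) :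
  (0 < #|V|)%N -> 0 <= b -> eta + 4 * w <= b ^+ 2 ->
  (1 - k.+1%:R^-1 - eta) * m ^+ 2 <= (arcs e setT setT)%:R ->
  dominating_clique e w x -> turan_partition b (clique_part x).
Proof.
rewrite /dominating_clique => V0 b0 b_ge edge_density dominating.
have m0 : 0 < m by rewrite ltr0n.
set c : R := #|common_nbrs e x|%:R in dominating.
have facets_le : \sum_i #|facet_nbrs e i x|%:R <= m + k%:R * c.
  by rewrite -natrM -natrD -natr_sum ler_nat sum_facet_nbrs_le.
have inner_ge0 : 0 <= (facet_arcs e x)%:R :> R by [].
have dominated := le_trans dominating (ler_wpM2l (ltW m0) facets_le).
have part_card i : #|clique_part x i|%:R = #|facet_nbrs e i x|%:R - c.
  rewrite /clique_part cardsD (setIidPr _) ?natrB ?subset_leq_card //;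
  by apply/subsetP => v; rewrite (common_nbrs_facet e i) => /andP[].
apply: (@turan_partition_of_deficiency _ _ eta w w) => //.
- by rewrite card_ord.
- exact: disjoint_clique_part.
- by rewrite card_ord.
- apply: le_trans (_ : (facet_arcs e x)%:R <= _).
    by rewrite natr_sum; apply: ler_sum => i _; rewrite ler_nat arcs_subset ?subsetDl.
  have c_ge0 : 0 <= m * c by rewrite mulr_ge0.
  by move: dominated; rewrite -natr1; lra.
- under eq_bigr do rewrite part_card.
  rewrite sumrB sumr_const card_ord -(mulr_natl c).
  by rewrite -(ler_pM2l m0); move: dominating inner_ge0; lra.
- by apply: le_trans b_ge; lra.
Qed.

Lemma exists_clique_turan_partition k (delta b : R) :
  let K := k.+1%:R in
  symmetric e -> (0 < #|V|)%N -> 0 <= delta -> 2 * K * k%:R * delta <= 1 -> 0 <= b ->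
  (1 + 4 * (K * k%:R + (2 * K) ^+ k.+2)) * delta <= b ^+ 2 ->
  (1 - K^-1 - delta) * m ^+ 2 <= (arcs e setT setT)%:R ->
  #|cliques e k.+2|%:R <= delta * m ^+ k.+2 ->
  exists x : {ffun 'I_k.+1 -> V}, turan_partition b (clique_part x).
Proof.
move=> K e_sym V0 delta0 delta_small b0 delta_b dense few.
have m0 : 0 < m by rewrite ltr0n.
have KE : K = k%:R + 1 by rewrite natr1.
have dense2 : (1 - (K^-1 + delta)) * m ^+ 2 <= #|cliques e 2|%:R.
  by rewrite card_cliques2 // opprD addrA.
have many : ((2 * K)^-1 * m) ^+ k.+1 <= #|cliques e k.+1|%:R.
  apply: (card_cliques_ge_expr e_sym dense2).
  - by rewrite addr_ge0 // invr_ge0 ltW.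
  - by rewrite invr_ge0 mulr_ge0 // ltW.
  have -> : k%:R = K - 1 by rewrite KE addrK.
  rewrite -(ler_pM2l (_ : 0 < 2 * K)) ?mulr_gt0 //.
  rewrite [leLHS](_ : _ = 2 * K - 1 + 2 * K * (K - 1) * delta); last first.
    by field; rewrite nat1r gt_eqF.
  by move: delta_small; rewrite KE; lra.
have [||x dominating] := exists_dominating_clique e_sym dense2 (k := k)
  (delta := (2 * K) ^+ k.+2 * delta).
- by rewrite -(ltr0n R) (lt_le_trans _ many) // exprn_gt0 ?mulr_gt0 ?invr_gt0 ?mulr_gt0.
- apply: le_trans (ler_wpM2l _ few) _; first by rewrite mulr_ge0 // ltW.
  rewrite [leLHS](_ : _ = (2 * K) ^+ k.+2 * delta * m * ((2 * K)^-1 * m) ^+ k.+1).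
    rewrite ler_wpM2l //.
    by rewrite mulr_ge0 // mulr_ge0 // exprn_ge0 // mulr_ge0 // ltW.
  rewrite [(_^-1 * _) ^+ _]exprMn exprVn !exprS; field.
  by rewrite nat1r expf_neq0 ?gt_eqF ?mulr_gt0.
exists x; apply: (turan_partition_clique_part V0 b0 _ dense (x := x)
  (w := (K * k%:R + (2 * K) ^+ k.+2) * delta)); first by lra.
rewrite (_ : _ * delta =
  1 + (2 * K) ^+ k.+2 * delta - K * (1 - k%:R * (K^-1 + delta))) //.
by field; rewrite nat1r gt_eqF.
Qed.

End TuranPartition.

Lemma exists_turan_partition (R : realFieldType) k (b : R) : 0 < b ->
  exists2 delta : R, 0 < delta & forall (V : finType) (e : rel V),
    symmetric e -> (0 < #|V|)%N ->
    (1 - k.+1%:R^-1 - delta) * #|V|%:R ^+ 2 <= (arcs e setT setT)%:R ->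
    #|cliques e k.+2|%:R <= delta * #|V|%:R ^+ k.+2 ->
  exists Q : 'I_k.+1 -> {set V}, turan_partition e b Q.
Proof.
move=> b0; pose K : R := k.+1%:R; pose B := (2 * K) ^+ k.+2.
have K0 : 0 <= K * k%:R by rewrite mulr_ge0.
have B0 : 0 < B by rewrite exprn_gt0 // mulr_gt0.
have D0 : 0 < 1 + 4 * (K * k%:R + B) by lra.
pose delta := Num.min (b ^+ 2) 1 / (1 + 4 * (K * k%:R + B)).
have delta0 : 0 < delta by rewrite divr_gt0 // lt_min exprn_gt0 /=.
have deltaE : (1 + 4 * (K * k%:R + B)) * delta = Num.min (b ^+ 2) 1.
  by rewrite mulrC divfK ?gt_eqF.
exists delta => // V e e_sym V0 dense few.
have [||x Qx] :=
  exists_clique_turan_partition e_sym V0 (ltW delta0) _ (ltW b0) _ dense few.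
- have : (1 + 4 * (K * k%:R + B)) * delta <= 1 by rewrite deltaE ge_min lexx orbT.
  apply: le_trans; rewrite ler_pM2r // -mulrA -/K; lra.
- by rewrite deltaE ge_min lexx.
by exists (clique_part e x).
Qed.

(** * Few pairwise disjoint tuples *)

Section AvoidingCliques.
Local Open Scope nat_scope.
Variables (T V : finType) (f : V -> {set T}).

Definition disj_rel : rel V := fun a b => [disjoint f a & f b].

Definition hull r (z : {ffun 'I_r -> V}) : {set T} := \bigcup_j f (z j).

Definition avoiding (U : {set T}) : {set V} := [set v | [disjoint f v & U]].

Definition avoiding_cliques r (S : {set T}) : {set {ffun 'I_r -> V}} :=
  [set y in cliques disj_rel r | [disjoint hull y & S]].

Lemma disj_rel_sym : symmetric disj_rel.
Proof. by move=> a b; rewrite /disj_rel disjoint_sym. Qed.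

Lemma disjoint_setUl (A B C : {set T}) :
  [disjoint A :|: B & C] = [disjoint A & C] && [disjoint B & C].
Proof. by rewrite -!setI_eq0 setIUl setU_eq0. Qed.

Lemma disjoint_setUr (A B C : {set T}) :
  [disjoint A & B :|: C] = [disjoint A & B] && [disjoint A & C].
Proof. by rewrite -!setI_eq0 setIUr setU_eq0. Qed.

Lemma hull_ins r (i : 'I_r.+1) v y : hull (ffun_ins i v y) = f v :|: hull y.
Proof.
rewrite /hull (bigD1_ord i) //= ffun_ins_id; congr (_ :|: _).
by apply: eq_bigr => j _; rewrite ffun_ins_lift.
Qed.

Lemma common_nbrs_disj_rel r (y : {ffun 'I_r -> V}) :
  common_nbrs disj_rel y = avoiding (hull y).
Proof.
apply/setP => v; rewrite !inE.
by apply/forallP/bigcup_disjointP => vy i; [move=> _|]; exact: vy.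
Qed.

Lemma mem_ffun_on_avoiding t (z : {ffun 'I_t -> V}) (U : {set T}) :
  (z \in ffun_on (avoiding U)) = [disjoint hull z & U].
Proof.
rewrite disjoint_sym; apply/ffun_onP/bigcup_disjointP => zU i; first move=> _;
by have := zU i; rewrite inE disjoint_sym => ->.
Qed.

Lemma avoiding_cliques_set0 r : avoiding_cliques r set0 = cliques disj_rel r.
Proof.
by apply/setP => y; rewrite inE -[X in _ && X]setI_eq0 setI0 eqxx andbT.
Qed.

Lemma card_avoiding_cliquesS r S :
  #|avoiding_cliques r.+1 S| =
  \sum_(y in avoiding_cliques r S) #|avoiding (hull y :|: S)|.
Proof.
rewrite -sum1dep_card big_mkcondr (big_cliquesS disj_rel_sym _ ord0) /=.
under [RHS]eq_bigl do rewrite inE.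
rewrite [RHS]big_mkcondr; apply: eq_bigr => y _.
rewrite common_nbrs_disj_rel -big_mkcondr /=.
under eq_bigl do rewrite inE hull_ins disjoint_setUl andbA -disjoint_setUr.
rewrite -[#|_|]sum1dep_card; case: ifP => _; first by under eq_bigl do rewrite andbT.
by rewrite big_pred0 // => v; rewrite andbF.
Qed.

Lemma sum_expn_card_avoiding r S t :
  \sum_(y in avoiding_cliques r S) #|avoiding (hull y :|: S)| ^ t =
  \sum_(z : {ffun 'I_t -> V} | [disjoint hull z & S])
     #|avoiding_cliques r (S :|: hull z)|.
Proof.
transitivity (\sum_(y in avoiding_cliques r S)
    \sum_(z : {ffun 'I_t -> V} | [disjoint hull z & hull y :|: S]) 1).
  apply: eq_bigr => y _; rewrite -[X in _ ^ X](card_ord t) -card_ffun_on -sum1_card.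
  by apply: eq_bigl => z; rewrite mem_ffun_on_avoiding.
rewrite (exchange_big_dep (fun z : {ffun 'I_t -> V} => [disjoint hull z & S])) /=.
  apply: eq_bigr => z zS; rewrite -[RHS]sum1_card; apply: eq_bigl => y.
  by rewrite !inE !disjoint_setUr zS andbT -andbA [[disjoint hull z & _]]disjoint_sym.
by move=> y z _; rewrite disjoint_setUr => /andP[].
Qed.

Hypothesis f_inj : injective f.

Lemma card_subset_family_le (U : {set T}) : #|[set v | f v \subset U]| <= 2 ^ #|U|.
Proof.
rewrite -card_powerset -(card_imset _ f_inj); apply/subset_leq_card/subsetP.
by move=> _ /imsetP[v + ->]; rewrite powersetE inE.
Qed.

Lemma card_small_hull_le t s :
  #|[set z : {ffun 'I_t -> V} | #|hull z| <= s]| <= 2 ^ #|T| * 2 ^ (s * t).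
Proof.
rewrite -sum1dep_card (partition_big (@hull t) (fun U => #|U| <= s)) //=.
apply: leq_trans (_ : \sum_(U : {set T} | #|U| <= s) 2 ^ (s * t) <= _); last first.
  rewrite sum_nat_const leq_mul2r (leq_trans (max_card _)) ?orbT //.
  by rewrite -cardsT -powersetT card_powerset cardsT.
apply: leq_sum => U Us; rewrite sum1dep_card.
apply: leq_trans (_ : #|ffun_on [set v | f v \subset U] : pred {ffun 'I_t -> V}| <= _).
  apply/subset_leq_card/subsetP => z; rewrite !inE => /andP[_ /eqP zU].
  by apply/ffun_onP => j; rewrite inE -zU; exact: bigcup_sup.
rewrite card_ffun_on card_ord expnM; case: t => // t; rewrite leq_exp2r //.
by apply: leq_trans (card_subset_family_le U) _; exact: leq_pexp2l.
Qed.

End AvoidingCliques.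

(* For t = 2k(k + 1) there are at most 2^(|T| + t |T| / (k + 1)) = 2^((2k + 1)|T|)
   tuples with a small hull, whereas |V|^t >= 2^((2k + 2)|T|). *)
Lemma expn_mul_card_small_hull_le (T V : finType) (f : V -> {set T}) k :
  injective f -> (0 < k)%N -> (2 ^ #|T| <= #|V| ^ k)%N ->
  (2 ^ #|T| * #|[set z : {ffun 'I_(2 * (k * k.+1)) -> V} |
                  #|hull f z| <= #|T| %/ k.+1]| <= #|V| ^ (2 * (k * k.+1)))%N.
Proof.
move=> f_inj k0 V_large; set s := (#|T| %/ k.+1)%N.
apply: leq_trans (_ : (2 ^ #|T|) ^ (2 * k.+1) <= _)%N; last first.
  by rewrite mulnCA [leqRHS]expnM leq_exp2r // muln_gt0.
apply: leq_trans (leq_mul (leqnn _) (card_small_hull_le f_inj _ _)) _.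
rewrite mulnA -!expnD -expnM leq_exp2l //.
have : (s * k.+1 <= #|T|)%N by exact: leq_divM.
nia.
Qed.

Section FewAvoidingCliques.
Variables (R : realFieldType) (T V : finType) (f : V -> {set T}).
Local Notation m := (#|V|%:R : R).

Lemma card_ffun_set_le t (A : {set {ffun 'I_t -> V}}) : #|A|%:R <= m ^+ t.
Proof. by rewrite -natrX ler_nat (leq_trans (max_card _)) // card_ffun card_ord. Qed.

Lemma sum_expr_card_avoiding_le r (S : {set T}) t s (c : R) : 0 <= c ->
  #|[set z : {ffun 'I_t -> V} | (#|hull f z| <= s)%N]|%:R <= c * m ^+ t ->
  (forall U : {set T}, (s < #|U|)%N -> [disjoint U & S] ->
     #|avoiding_cliques f r (S :|: U)|%:R <= c * m ^+ r) ->
  \sum_(y in avoiding_cliques f r S) #|avoiding f (hull f y :|: S)|%:R ^+ t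
  <= 2 * c * m ^+ t * m ^+ r.
Proof.
move=> c0 small_hulls few; under eq_bigr do rewrite -natrX.
rewrite -natr_sum sum_expn_card_avoiding natr_sum.
rewrite (bigID (fun z => #|hull f z| <= s)%N) /=.
apply: le_trans (_ : c * m ^+ t * m ^+ r + c * m ^+ r * m ^+ t <= _); last by lra.
apply: lerD.
  apply: le_trans (ler_wpM2r (exprn_ge0 _ _) small_hulls) => //.
  rewrite -sum1_card natr_sum mulr_suml.
  under [leRHS]eq_bigl do rewrite inE.
  rewrite big_mkcondl; apply: ler_sum => z _.
  by rewrite mul1r; case: ifP => _; rewrite ?card_ffun_set_le ?exprn_ge0.
apply: le_trans (_ : \sum_(z : {ffun 'I_t -> V}) c * m ^+ r <= _); last first.
  by rewrite sumr_const card_ffun card_ord -[leLHS]mulr_natr natrX.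
rewrite big_mkcond; apply: ler_sum => z _; case: ifP => [/andP[zS]|_].
  by rewrite -ltnNge => /few; apply.
by rewrite mulr_ge0 ?exprn_ge0.
Qed.

Lemma card_avoiding_cliquesS_le r (S : {set T}) t s (tau : R) :
  (0 < t)%N -> (0 < #|V|)%N -> 0 < tau ->
  #|[set z : {ffun 'I_t -> V} | (#|hull f z| <= s)%N]|%:R <= tau ^+ t / 2 * m ^+ t ->
  (forall U : {set T}, (s < #|U|)%N -> [disjoint U & S] ->
     #|avoiding_cliques f r (S :|: U)|%:R <= tau ^+ t / 2 * m ^+ r) ->
  #|avoiding_cliques f r.+1 S|%:R <= tau * m ^+ r.+1.
Proof.
case: t => // t _ V0 tau0 small_hulls few; have m0 : 0 < m by rewrite ltr0n.
rewrite card_avoiding_cliquesS natr_sum exprS mulrA.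
apply: (@sum_le_of_sum_expr_le _ _ _ _ _ _ t) => //.
- by rewrite mulr_gt0.
- exact: card_ffun_set_le.
apply: le_trans (sum_expr_card_avoiding_le _ small_hulls few) _.
  by rewrite divr_ge0 ?exprn_ge0 // ltW.
by rewrite exprMn; lra.
Qed.

End FewAvoidingCliques.

(* The lower bound on #|S| says that r sets with more than |T| / (k + 1) elements
   do not fit disjointly outside S; the induction absorbs unions of members into S. *)
Lemma few_avoiding_cliques (R : archiRealFieldType) k r (tau : R) :
  (0 < k)%N -> 0 < tau ->
  exists n0, forall (T V : finType) (f : V -> {set T}),
    injective f -> (n0 <= #|T|)%N -> (2 ^ #|T| <= #|V| ^ k)%N ->
  forall S : {set T}, (#|T| < #|S| + r * (#|T| %/ k.+1).+1)%N ->
  #|avoiding_cliques f r S|%:R <= tau * #|V|%:R ^+ r.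
Proof.
move=> k0; elim: r tau => [|r IHr] tau tau0.
  by exists 0%N => T V f _ _ _ S; rewrite addn0 ltnNge max_card.
pose t := (2 * (k * k.+1))%N; pose c := tau ^+ t / 2.
have c0 : 0 < c by rewrite divr_gt0 ?exprn_gt0.
have [n1 few] := IHr _ c0; exists (maxn n1 (Num.bound c^-1)) => T V f f_inj.
rewrite geq_max => /andP[T_n1 T_bound] V_large S S_large.
have pow2_gt0 : 0 < 2 ^+ #|T| :> R by rewrite exprn_gt0.
have V0 : (0 < #|V|)%N.
  by case: posnP V_large => // ->; rewrite exp0n // leqNgt expn_gt0.
apply: (card_avoiding_cliquesS_le (t := t) (s := #|T| %/ k.+1)) => //.
- by rewrite /t !muln_gt0 k0.
- have pow2_large : c^-1 <= 2 ^+ #|T|.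
    apply: ltW (lt_le_trans (archi_boundP _) _); first by rewrite invr_ge0 ltW.
    by rewrite -natrX ler_nat (leq_trans T_bound) // ltnW // ltn_expl.
  rewrite -(ler_pM2l pow2_gt0); apply: le_trans (_ : #|V|%:R ^+ t <= _).
    by rewrite -!natrX -natrM ler_nat expn_mul_card_small_hull_le.
  rewrite mulrA ler_peMl ?exprn_ge0 // -ler_pdivrMr // mul1r //.
- move=> U U_large US; apply: few => //; apply: leq_trans S_large _.
  have/eqP -> : #|S :|: U| == (#|S| + #|U|)%N.
    by rewrite (leq_card_setU S U).2 disjoint_sym.
  by rewrite mulSn addnA leq_add2r leq_add2l.
Qed.

Lemma few_disjoint_cliques (R : archiRealFieldType) k (tau : R) :
  (0 < k)%N -> 0 < tau ->
  exists n0, forall (T V : finType) (f : V -> {set T}),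
    injective f -> (n0 <= #|T|)%N -> (2 ^ #|T| <= #|V| ^ k)%N ->
  #|cliques (disj_rel f) k.+1|%:R <= tau * #|V|%:R ^+ k.+1.
Proof.
move=> k0 /(few_avoiding_cliques k.+1 k0)[n0 few].
exists n0 => T V f f_inj T_large V_large; rewrite -avoiding_cliques_set0.
by apply: few; rewrite // cards0 add0n mulnC ltn_ceil.
Qed.

(** * Families in which every element is rare *)

Definition star (T V : finType) (f : V -> {set T}) (P : {set V}) (x : T) : {set V} :=
  [set v in P | x \in f v].

Lemma sum_card_setI (T V : finType) (f : V -> {set T}) (P : {set V}) (Z : {set T}) :
  (\sum_(v in P) #|f v :&: Z| = \sum_(x in Z) #|star f P x|)%N.
Proof.
transitivity (\sum_(v in P) \sum_(x in Z) (x \in f v))%N.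
  apply: eq_bigr => v _; rewrite -sum1_card.
  by under eq_bigl do rewrite inE andbC; rewrite big_mkcondr.
rewrite exchange_big; apply: eq_bigr => x _ /=.
by rewrite -sum1dep_card big_mkcondr.
Qed.

Lemma sum_weight_cube_le (R : realFieldType) (T V : finType) (f : V -> {set T})
    (S Z : {set T}) (P : {set V}) (l : R) :
  injective f -> 0 <= l -> [disjoint S & Z] ->
  (forall v, v \in P -> f v \subset S :|: Z) ->
  \sum_(v in P) l ^+ #|f v :&: Z| <= 2 ^+ #|S| * (1 + l) ^+ #|Z|.
Proof.
move=> f_inj l0 disSZ Psub.
pose w x : R := if x \in S then 1 else if x \in Z then l else 0.
have w0 x : 0 <= w x by rewrite /w; case: ifP => // _; case: ifP.
pose W (A : {set T}) : R := \prod_x (if x \in A then w x else 1).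
have W0 A : 0 <= W A by apply: prodr_ge0 => x _; case: ifP.
have -> : 2 ^+ #|S| * (1 + l) ^+ #|Z| = \sum_A W A.
  rewrite -bigA_distr -!prodr_const [X in X * _ = _]big_mkcond.
  rewrite [X in _ * X = _]big_mkcond -big_split; apply: eq_bigr => x _ /=; rewrite /w.
  by case: ifP => [/(disjointFr disSZ)->|_]; last case: ifP => _; ring.
have WE v : v \in P -> l ^+ #|f v :&: Z| = W (f v).
  move=> /Psub/subsetP fv; rewrite -prodr_const big_mkcond; apply: eq_bigr => x _.
  rewrite inE /w; have [xv|//] := boolP (x \in f v); have := fv x xv; rewrite inE.
  by have [xS _|_ /= ->] := boolP (x \in S); rewrite // (disjointFr disSZ xS).
rewrite (eq_bigr _ WE) -(big_imset W (in2W f_inj)) /=.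
by rewrite big_mkcond; apply: ler_sum => A _; case: ifP.
Qed.

Section SparseFamilies.
Variable R : realType.

Lemma expR_average_le (I : finType) (A : {set I}) (f : I -> R) (c : R) :
  c * #|A|%:R <= \sum_(i in A) f i -> expR c * #|A|%:R <= \sum_(i in A) expR (f i).
Proof.
move=> c_le; apply: le_trans (_ : \sum_(i in A) expR c * (1 + (f i - c)) <= _).
  rewrite -mulr_sumr ler_pM2l ?expR_gt0 // big_split sumrB /= !sumr_const.
  by rewrite -(mulr_natr c) lerDl subr_ge0.
apply: ler_sum => i _; rewrite -[X in _ <= expR X](subrKC c) expRD.
by rewrite ler_pM2l ?expR_gt0 // expR_ge1Dx.
Qed.

(* Average the weights expR (- L) ^+ #|f v :&: Z| over P: their exponents have
   mean at most #|Z| / L ^+ 2. *)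
Lemma card_sparse_family_le (T V : finType) (f : V -> {set T}) (S Z : {set T})
    (P : {set V}) (L : R) :
  injective f -> 0 < L -> [disjoint S & Z] ->
  (forall v, v \in P -> f v \subset S :|: Z) ->
  (forall x, x \in Z -> #|star f P x|%:R <= #|P|%:R / L ^+ 2) ->
  #|P|%:R <= 2 ^+ #|S| * expR (2 * #|Z|%:R / L).
Proof.
move=> f_inj L0 disSZ Psub sparse.
have mean : - (#|Z|%:R / L) * #|P|%:R <= \sum_(v in P) (- L) * #|f v :&: Z|%:R.
  rewrite -mulr_sumr -natr_sum sum_card_setI !mulNr lerN2.
  rewrite [leRHS](_ : _ = L * (#|P|%:R / L ^+ 2 *+ #|Z|)); last first.
    by rewrite -mulr_natr; field; rewrite gt_eqF.
  by rewrite ler_pM2l // natr_sum -sumr_const; apply: ler_sum.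
have weight_le : 1 + expR (- L) <= expR L^-1.
  apply: le_trans (expR_ge1Dx _); rewrite lerD2l expRN lef_pV2 ?posrE ?expR_gt0 //.
  by apply: le_trans (expR_ge1Dx L); rewrite lerDr.
have := expR_average_le mean.
under [leRHS]eq_bigr do rewrite mulrC expRM_natl.
move=> /le_trans/(_ (sum_weight_cube_le f_inj (expR_ge0 _) disSZ Psub)).
rewrite (expRN (_ / L)) ler_pdivrMl ?expR_gt0 // => /le_trans; apply.
rewrite (_ : 2 * _ / L = #|Z|%:R / L + #|Z|%:R * L^-1); last by ring.
rewrite expRD mulrCA ler_pM2l ?exprn_gt0 // ler_pM2l ?expR_gt0 //.
by rewrite expRM_natl lerXn2r ?nnegrE ?addr_ge0 ?expR_ge0.
Qed.

Lemma expR_third_le : expR (1 / 3) <= 3 / 2 :> R.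
Proof.
rewrite -[1 / 3]opprK expRN -[3 / 2]invrK.
rewrite lef_pV2 ?posrE ?expR_gt0 ?invr_gt0 ?divr_gt0 //.
by apply: le_trans (expR_ge1Dx _); lra.
Qed.

Section TightFamilies.
Variables (T V I : finType) (f : V -> {set T}) (S : I -> {set T}) (P : I -> {set V}).
Variable y : R.
Hypothesis f_inj : injective f.
Hypothesis I_gt0 : (0 < #|I|)%N.
Hypothesis Sdis : pairwise_disjoint S.
Local Notation Z := (~: \bigcup_i S i).
Hypothesis P_subset : forall i v, v \in P i -> f v \subset S i :|: Z.
(* The factor 6 makes the K-th power of expR (2 / (6 K)) less than 7 / 4. *)
Hypothesis P_sparse : forall i x, x \in Z ->
  #|star f (P i) x|%:R <= #|P i|%:R / (6 * #|I|%:R) ^+ 2 :> R.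
Hypothesis y_ge0 : 0 <= y.
Hypothesis y_large : 7 / 8 * 2 ^+ #|T| <= y ^+ #|I|.
Hypothesis P_large : forall i, y <= #|P i|%:R.

Lemma sum_card_cells : (\sum_i #|S i| + #|Z| = #|T|)%N.
Proof. by rewrite -card_bigcup_disjoint // cardsC. Qed.

Lemma card_cell_family_le i :
  #|P i|%:R <= 2 ^+ #|S i| * expR (2 * #|Z|%:R / (6 * #|I|%:R)) :> R.
Proof.
apply: (card_sparse_family_le f_inj _ _ (@P_subset i) (@P_sparse i)).
  by rewrite mulr_gt0 // ltr0n.
by rewrite disjoint_sym disjoints_subset setCS (bigcup_sup i).
Qed.

Lemma cells_cover : Z = set0.
Proof.
apply/eqP; rewrite -cards_eq0; apply: contraTT y_large; rewrite -lt0n -ltNge => Z0.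
apply: le_lt_trans (_ : 2 ^+ (\sum_i #|S i|)%N * (3 / 2) ^+ #|Z| < _).
  pose bound i : R := 2 ^+ #|S i| * expR (2 * #|Z|%:R / (6 * #|I|%:R)).
  apply: le_trans (_ : \prod_i bound i <= _).
    rewrite -prodr_const; apply: ler_prod => i _.
    by rewrite y_ge0 (le_trans (P_large i)) ?card_cell_family_le.
  rewrite big_split prodrXr prodr_const ler_pM2l ?exprn_gt0 //= -expRM_natl.
  rewrite (_ : #|I|%:R * _ = #|Z|%:R * (1 / 3)); last first.
    by field; rewrite pnatr_eq0 -lt0n.
  by rewrite expRM_natl lerXn2r ?nnegrE ?expR_ge0 ?divr_ge0 ?expR_third_le.
rewrite -[X in _ < _ * 2 ^+ X]sum_card_cells exprD mulrCA ltr_pM2l ?exprn_gt0 //.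
case: #|Z| Z0 => // z _; rewrite !exprS.
have : (3 / 2) ^+ z <= 2 ^+ z :> R by rewrite lerXn2r ?nnegrE //; lra.
have : 0 < 2 ^+ z :> R by rewrite exprn_gt0.
lra.
Qed.

Lemma card_cell_ge i : (#|T| <= #|I| * #|S i|)%N.
Proof.
rewrite leqNgt; apply/negP => small; move: y_large; apply/negP; rewrite -ltNge.
have y_le : y <= 2 ^+ #|S i|.
  apply: le_trans (P_large i) (le_trans (card_cell_family_le i) _).
  by rewrite cells_cover cards0 mulr0 mul0r expR0 mulr1.
apply: le_lt_trans (lerXn2r #|I| y_ge0 _ y_le) _; first by rewrite nnegrE exprn_ge0.
rewrite -exprM mulnC.
have : 2 ^+ (#|I| * #|S i|).+1 <= 2 ^+ #|T| :> R by rewrite ler_eXn2l // ltr1n.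
have : 0 < 2 ^+ #|T| :> R by rewrite exprn_gt0.
rewrite exprS; lra.
Qed.

Lemma card_cell i : (#|I| * #|S i|)%N = #|T|.
Proof.
have /leqif_sum[_ /esym] j : predT j ->
    (#|T| <= #|I| * #|S j| ?= iff (#|T| == #|I| * #|S j|))%N.
  by split; first exact: card_cell_ge.
have sumS : (\sum_i #|S i| = #|T|)%N by rewrite -sum_card_cells cells_cover cards0 addn0.
by rewrite sum_nat_const -big_distrr /= sumS eqxx => /forallP/(_ i)/eqP <-.
Qed.

Lemma sparse_families_tight : Z = set0 /\ forall i, (#|I| * #|S i|)%N = #|T|.
Proof. by split; [exact: cells_cover | exact: card_cell]. Qed.

End TightFamilies.
End SparseFamilies.

(** * From a partition of the family to a partition of the ground set *)

Section PopularElements.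
Variables (R : realFieldType) (T V : finType) (f : V -> {set T}) (b : R).
Hypothesis b_gt0 : 0 < b.
Hypothesis V_gt0 : (0 < #|V|)%N.
Local Notation m := (#|V|%:R : R).

Definition popular (A : {set V}) : {set T} :=
  [set x | b * m < #|star f A x|%:R].

Definition meeting (A : {set V}) (U : {set T}) : {set V} :=
  [set v in A | ~~ [disjoint f v & U]].

Lemma arcs_add_nonarcs (A B : {set V}) :
  (arcs (disj_rel f) A B + \sum_(a in A) #|meeting B (f a)| = #|A| * #|B|)%N.
Proof.
rewrite /arcs -big_split /= -sum_nat_const; apply: eq_bigr => a _.
rewrite -sum1dep_card big_mkcondr -big_split -sum1_card; apply: eq_bigr => c _ /=.
by rewrite /disj_rel disjoint_sym; case: [disjoint _ & _].
Qed.

Lemma card_meeting_popular_le (A B : {set V}) :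
  (#|A| * #|B|)%:R - b ^+ 2 * m ^+ 2 <= (arcs (disj_rel f) A B)%:R ->
  #|meeting A (popular B)|%:R <= b * m.
Proof.
have bm0 : 0 < b * m by rewrite mulr_gt0 // ltr0n.
rewrite -arcs_add_nonarcs natrD natr_sum => dense; rewrite -(ler_pM2r bm0).
apply: le_trans (_ : \sum_(a in A) #|meeting B (f a)|%:R <= _); last by lra.
rewrite mulr_natl -sumr_const big_mkcond [leRHS]big_mkcond /=.
apply: ler_sum => a _; rewrite inE; case: (a \in A) => //=.
case: ifPn => // /pred0Pn[x /= /andP[xa]]; rewrite inE => /ltW/le_trans; apply.
rewrite ler_nat; apply/subset_leq_card/subsetP => c; rewrite !inE => /andP[-> xc] /=.
by apply/pred0Pn; exists x; rewrite /= xc xa.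
Qed.

Section Cores.
Variables (I : finType) (Q : I -> {set V}).
Hypothesis Q_turan : turan_partition (disj_rel f) b Q.
Local Notation S i := (popular (Q i)).
Local Notation K := (#|I|%:R : R).

Definition core (i : I) : {set V} :=
  Q i :\: \bigcup_(j | j != i) meeting (Q i) (S j).

Lemma card_meeting_le i j : i != j -> #|meeting (Q i) (S j)|%:R <= b * m.
Proof. by case: Q_turan => _ _ dense ij; apply/card_meeting_popular_le/dense. Qed.

Lemma disjoint_popular : pairwise_disjoint (fun i => S i).
Proof.
move=> i j ij; apply/pred0P => x /=; apply/negP => /andP[xi xj].
move: (xi); rewrite inE ltNge (le_trans _ (card_meeting_le ij)) // ler_nat.
apply/subset_leq_card/subsetP => v; rewrite !inE => /andP[-> xv] /=.
by apply/pred0Pn; exists x; rewrite /= xv.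
Qed.

Lemma disjoint_core : pairwise_disjoint core.
Proof. by case: Q_turan => Qdis _ _ i j /Qdis; apply: disjointW; exact: subsetDl. Qed.

Lemma card_core_ge i : (K^-1 - K * b) * m <= #|core i|%:R.
Proof.
have [_ /(_ i) Q_large _] := Q_turan.
have removed : #|\bigcup_(j | j != i) meeting (Q i) (S j)|%:R <= (K - 1) * (b * m).
  apply: le_trans (_ : \sum_(j | j != i) #|meeting (Q i) (S j)|%:R <= _).
    rewrite -natr_sum ler_nat; apply: (big_ind2 (fun (A : {set V}) c => #|A| <= c)%N).
    - by rewrite cards0.
    - by move=> A a B c Aa Bc; rewrite (leq_trans (leq_card_setU A B)) // leq_add.
    - by [].
  have I0 : (0 < #|I|)%N by apply/card_gt0P; exists i.
  rewrite -(natrB _ I0) subn1 -(cardC1 i) mulr_natl -sumr_const.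
  by apply: ler_sum => j ji; apply: card_meeting_le; rewrite eq_sym.
have : #|Q i|%:R <= #|core i|%:R + (K - 1) * (b * m).
  rewrite -lerBlDl; apply: le_trans removed; rewrite lerBlDl -natrD ler_nat addnC.
  by rewrite -leq_subLR /core cardsD leq_sub2l // subset_leq_card // subsetIr.
have : 0 <= b * m by rewrite mulr_ge0 // ltW.
lra.
Qed.

Lemma core_subset (i : I) v : v \in core i -> f v \subset S i :|: ~: \bigcup_j S j.
Proof.
rewrite inE => /andP[v_avoids vQ]; apply/subsetP => x xv; rewrite in_setU in_setC.
have [//|xi /=] := boolP (x \in S i); apply/bigcupP => -[j _ xj].
have ji : j != i by apply: contraNneq xi => <-.
move/negP: v_avoids; apply; apply/bigcupP; exists j => //.
by rewrite inE vQ; apply/pred0Pn; exists x; rewrite /= xv.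
Qed.

Lemma card_core_unpopular_le (i : I) (x : T) : x \notin \bigcup_j S j ->
  #|star f (core i) x|%:R <= b * m.
Proof.
move=> x_unpopular; apply: le_trans (_ : #|star f (Q i) x|%:R <= _).
  rewrite ler_nat; apply/subset_leq_card/subsetP => v.
  by rewrite !inE => /andP[/andP[_ ->] ->].
rewrite leNgt; apply: contra x_unpopular => xi.
by apply/bigcupP; exists i => //; rewrite inE.
Qed.

Lemma card_outside_cores_le :
  (0 < #|I|)%N -> m - \sum_i #|core i|%:R <= K ^+ 2 * b * m.
Proof.
move=> I0; have : \sum_(i : I) (K^-1 - K * b) * m <= \sum_i #|core i|%:R.
  by apply: ler_sum => i _; exact: card_core_ge.
rewrite sumr_const -[X in X <= _]mulr_natl.
have -> : K * ((K^-1 - K * b) * m) = m - K ^+ 2 * b * m.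
  by field; rewrite pnatr_eq0 -lt0n.
lra.
Qed.

End Cores.
End PopularElements.

Definition outside_cubes (T V I : finType) (f : V -> {set T}) (S : I -> {set T}) :
    {set V} :=
  [set v | ~~ [exists i, f v \subset S i]].

Definition cube_partition (R : realFieldType) (T V I : finType) (f : V -> {set T}) (c : R)
    (S : I -> {set T}) : Prop :=
  [/\ pairwise_disjoint S, \bigcup_i S i = setT,
      forall i, (#|I| * #|S i|)%N = #|T| & #|outside_cubes f S|%:R <= c * #|V|%:R].

Section CubePartition.
Variables (R : realType) (T V I : finType) (f : V -> {set T}) (b eta x : R).
Variable Q : I -> {set V}.
Local Notation K := (#|I|%:R : R).
Local Notation m := (#|V|%:R : R).
Hypothesis I_gt0 : (0 < #|I|)%N.
Hypothesis V_gt0 : (0 < #|V|)%N.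
Hypothesis b_gt0 : 0 < b.
(* This and eta_small below give
   (6 K)^2 b m <= (K^-1 - K b) m and (1 - (8 K)^-1) x <= (K^-1 - K b) m. *)
Hypothesis b_small : 72 * K ^+ 3 * b <= 1.
Hypothesis Q_turan : turan_partition (disj_rel f) b Q.

Lemma card_core_rare_le i z : z \in ~: (\bigcup_j popular f b (Q j)) ->
  #|star f (core f b Q i) z|%:R <= #|core f b Q i|%:R / (6 * K) ^+ 2 :> R.
Proof.
have K0 : 0 < K by rewrite ltr0n.
have K1 : 1 <= K by rewrite ler1n.
rewrite in_setC => z_unpopular; apply: le_trans (card_core_unpopular_le i z_unpopular) _.
rewrite ler_pdivlMr ?exprn_gt0 ?mulr_gt0 //.
apply: le_trans (card_core_ge b_gt0 V_gt0 Q_turan i).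
rewrite mulrAC ler_pM2r ?ltr0n // -(ler_pM2l K0) mulrBr divff ?gt_eqF //.
have : K ^+ 2 * b <= K ^+ 3 * b by rewrite ler_pM2r // ler_weXn2l.
by move: b_small; lra.
Qed.

Hypothesis eta_small : 16 * K * eta <= 1.
Hypothesis x_gt0 : 0 < x.
Hypothesis m_large : (1 - eta) * K * x <= m.

Lemma card_core_ge_shrunk_root i : (1 - (8 * K)^-1) * x <= #|core f b Q i|%:R.
Proof.
have K0 : 0 < K by rewrite ltr0n.
have K1 : K^-1 <= 1 by rewrite invf_le1 ?ler1n.
have Kinv0 : 0 < K^-1 by rewrite invr_gt0.
have b_le : K ^+ 2 * b <= K^-1 / 72.
  by rewrite ler_pdivlMl //; move: b_small; lra.
have eta_le : eta <= K^-1 / 16.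
  by rewrite ler_pdivlMl //; move: eta_small; lra.
apply: le_trans (card_core_ge b_gt0 V_gt0 Q_turan i).
have Kb : 0 <= K^-1 - K * b.
  rewrite -(pmulr_rge0 _ K0) mulrBr divff ?gt_eqF //; lra.
apply: le_trans (ler_wpM2l Kb m_large).
have -> : (K^-1 - K * b) * ((1 - eta) * K * x) = (1 - K ^+ 2 * b) * (1 - eta) * x.
  by field; rewrite gt_eqF.
rewrite ler_pM2r // invfM.
apply: le_trans (_ : (1 - K^-1 / 72) * (1 - K^-1 / 16) <= _); first by nra.
by apply: ler_pM; lra.
Qed.

Lemma shrink_factor_ge0 : 0 <= 1 - (8 * K)^-1.
Proof. by rewrite subr_ge0 invf_le1 ?mulr_gt0 ?ltr0n // mulr_ege1 ?ler1n. Qed.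

Lemma expr_shrunk_root_ge : x ^+ #|I| = 2 ^+ #|T| ->
  7 / 8 * 2 ^+ #|T| <= ((1 - (8 * K)^-1) * x) ^+ #|I|.
Proof.
move=> xE; rewrite exprMn xE ler_pM2r ?exprn_gt0 //.
have := expr_ge_tangent #|I|.-1 ler01 shrink_factor_ge0; rewrite prednK // !expr1n.
apply: le_trans; rewrite mulr1 [leRHS](_ : _ = 7 / 8) //.
by field; rewrite pnatr_eq0 -lt0n.
Qed.

Hypothesis f_inj : injective f.
Hypothesis x_root : x ^+ #|I| = 2 ^+ #|T|.

Lemma exists_cube_partition : exists S : I -> {set T}, cube_partition f (K ^+ 2 * b) S.
Proof.
have S_dis := disjoint_popular b_gt0 V_gt0 Q_turan.
have shrunk_root_ge0 := mulr_ge0 shrink_factor_ge0 (ltW x_gt0).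
have [coverC cardS] := sparse_families_tight f_inj I_gt0 S_dis
  (core_subset (b := b) (Q := Q)) card_core_rare_le shrunk_root_ge0
  (expr_shrunk_root_ge x_root) card_core_ge_shrunk_root.
exists (fun i => popular f b (Q i)); split=> //.
  by rewrite -[LHS]setCK coverC setC0.
apply: le_trans (card_outside_cores_le b_gt0 V_gt0 Q_turan I_gt0).
rewrite lerBrDr -natr_sum -card_bigcup_disjoint; last exact: disjoint_core Q_turan.
rewrite -natrD ler_nat -(cardsC (\bigcup_i core f b Q i)) addnC leq_add2l.
apply/subset_leq_card/subsetP => v; rewrite !inE; apply: contra => /bigcupP[i _ vi].
by apply/existsP; exists i; have := core_subset vi; rewrite coverC setU0.
Qed.

End CubePartition.

(** * Stability for disjoint pairs *)

Lemma pow2_le_card_expn (R : realFieldType) (T V : finType) k (eta x : R) :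
  (0 < k)%N -> eta <= 1 / 2 -> 0 <= x -> x ^+ k.+1 = 2 ^+ #|T| ->
  (1 - eta) * k.+1%:R * x <= #|V|%:R -> (2 ^ #|T| <= #|V| ^ k.+1)%N.
Proof.
move=> k0 eta_le x0 xE V_large; rewrite -(ler_nat R) !natrX -xE.
rewrite lerXn2r ?nnegrE //; apply: le_trans V_large; rewrite ler_peMl //.
have : 2 <= k.+1%:R :> R by rewrite ler_nat.
nra.
Qed.

Lemma exists_cube_cover (R : realType) (eps : R) k : 0 < eps -> (0 < k)%N ->
  exists2 eta : R, 0 < eta & exists n0, forall (T V : finType) (f : V -> {set T}) (x : R),
    injective f -> (n0 <= #|T|)%N -> 0 < x -> x ^+ k.+1 = 2 ^+ #|T| ->
    (1 - eta) * k.+1%:R * x <= #|V|%:R ->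
    (1 - k.+1%:R^-1 - eta) * #|V|%:R ^+ 2 <= (arcs (disj_rel f) setT setT)%:R ->
  exists S : 'I_k.+1 -> {set T}, cube_partition f eps S.
Proof.
move=> eps0 k0; pose K : R := k.+1%:R.
have K1 : 1 <= K by rewrite ler1n.
have K0 : 0 < 72 * K ^+ 3 by rewrite mulr_gt0 ?exprn_gt0.
pose b := Num.min eps 1 / (72 * K ^+ 3).
have b0 : 0 < b by rewrite divr_gt0 // lt_min eps0 ltr01.
have bE : 72 * K ^+ 3 * b = Num.min eps 1 by rewrite mulrC divfK ?gt_eqF.
have b_small : 72 * K ^+ 3 * b <= 1 by rewrite bE ge_min lexx orbT.
have b_eps : K ^+ 2 * b <= eps.
  apply: le_trans (_ : 72 * K ^+ 3 * b <= _); last by rewrite bE ge_min lexx.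
  have : K ^+ 2 * b <= K ^+ 3 * b by rewrite ler_pM2r // ler_weXn2l.
  have : 0 < K ^+ 2 * b by rewrite mulr_gt0 ?exprn_gt0.
  lra.
have [delta delta0 turan] := exists_turan_partition k b0.
have [n0 few] := few_disjoint_cliques (ltn0Sn k) delta0.
pose eta := Num.min delta (16 * K)^-1.
have eta0 : 0 < eta by rewrite lt_min delta0 invr_gt0 mulr_gt0.
exists eta => //; exists n0 => T V f x f_inj T_large x0 xE V_large dense.
have eta_delta : eta <= delta by rewrite ge_min lexx.
have eta_small : 16 * K * eta <= 1.
  by rewrite mulrC -ler_pdivlMr ?mulr_gt0 // div1r ge_min lexx orbT.
have eta_half : eta <= 1 / 2.
  have : 0 <= eta * (K - 1) by rewrite mulr_ge0 ?subr_ge0 // ltW.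
  by move: eta_small; lra.
have pow2_le := pow2_le_card_expn k0 eta_half (ltW x0) xE V_large.
have V0 : (0 < #|V|)%N by case: posnP pow2_le => // ->; rewrite exp0n // leqNgt expn_gt0.
have [||Q Q_turan] := turan V (disj_rel f) (disj_rel_sym f) V0.
- by apply: le_trans dense; rewrite ler_wpM2r ?exprn_ge0 // lerB.
- exact: few.
have := exists_cube_partition _ V0 b0 _ Q_turan _ x0 _ f_inj (eta := eta).
rewrite card_ord => /(_ isT b_small eta_small V_large xE)[S [Sdis Scov Scard Sout]].
by exists S; split=> //; apply: le_trans Sout _; rewrite ler_wpM2r.
Qed.

Definition edges (V : finType) (e : rel V) : {set {set V}} :=
  [set [set p.1; p.2] | p in [set p | e p.1 p.2]].

Lemma double_card_edges_le (V : finType) (e : rel V) : symmetric e ->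
  (2 * #|edges e| <= arcs e setT setT + #|[set v | e v v]|)%N.
Proof.
move=> e_sym; pose E := [set p : V * V | e p.1 p.2].
have -> : arcs e setT setT = #|E|.
  rewrite /arcs pair_big_dep -sum1dep_card big_mkcond [RHS]big_mkcond.
  by apply: eq_bigr => p _; rewrite !inE.
rewrite -[#|E|]sum1_card (partition_big_imset (fun p => [set p.1; p.2])) /=.
rewrite -[#|[set v | _]|]sum1_card (partition_big set1 (mem (edges e))) /=; last first.
  by move=> v; rewrite inE => vv; apply/imsetP; exists (v, v); rewrite ?inE ?setUid.
rewrite -big_split mulnC -sum_nat_const; apply: leq_sum => _ /imsetP[[a c] + ->] /=.
rewrite inE /=; have [<- aa|a_neq_c ac] := eqVneq a c.
  apply: (@leq_add 1 1); rewrite sum1_card; apply/card_gt0P.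
    by exists (a, a); rewrite unfold_in /= inE aa eqxx.
  by exists a; rewrite unfold_in /= inE aa setUid eqxx.
apply: leq_trans (leq_addr _ _); rewrite sum1_card.
have <- : #|[set (a, c); (c, a)]| = 2%N by rewrite cards2 xpair_eqE negb_and a_neq_c.
apply/subset_leq_card/subsetP => p; rewrite in_set2 => /orP[]/eqP->;
  rewrite unfold_in /= inE /=.
  by rewrite ac eqxx.
by rewrite e_sym ac setUC eqxx.
Qed.

Local Notation member F := {A | A \in F}.

Lemma dpE n (F : {set {set 'I_n}}) :
  dp F = #|edges (disj_rel (val : member F -> {set 'I_n}))|.
Proof.
rewrite -(card_imset _ (imset_inj val_inj)); apply: eq_card => P; rewrite inE.
apply/exists_inP/imsetP => [[A AF /exists_inP[B BF /andP[AB /eqP ->]]]|].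
  exists [set exist _ A AF; exist _ B BF]; last by rewrite imsetU1 imset_set1.
  by apply/imsetP; exists (exist _ A AF, exist _ B BF); rewrite ?inE.
move=> [_ /imsetP[[[A AF] [B BF]] /[!inE] AB ->] ->]; exists A => //.
by apply/exists_inP; exists B => //; rewrite imsetU1 imset_set1 /= eqxx andbT.
Qed.

Lemma double_dp_le n (F : {set {set 'I_n}}) :
  (2 * dp F <= (arcs (disj_rel (val : member F -> {set 'I_n})) setT setT).+1)%N.
Proof.
rewrite dpE -[leqRHS]addn1; apply: leq_trans (double_card_edges_le (disj_rel_sym _)) _.
rewrite leq_add2l; apply/card_le1_eqP => u v; rewrite !inE /disj_rel -!setI_eq0 !setIid.
by move=> /eqP u0 /eqP v0; apply: val_inj; rewrite u0.
Qed.

Lemma arcs_ge_of_dp_ge (R : realFieldType) n (F : {set {set 'I_n}}) (c delta : R) :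
  2 <= delta * #|F|%:R -> (1 - c - delta / 2) * #|F|%:R ^+ 2 / 2 <= (dp F)%:R ->
  (1 - c - delta) * #|F|%:R ^+ 2
  <= (arcs (disj_rel (val : member F -> _)) setT setT)%:R.
Proof.
move=> F_large dp_large.
have dp_le :
    2 * (dp F)%:R <= (arcs (disj_rel (val : member F -> _)) setT setT)%:R + 1 :> R.
  by rewrite natr1 -natrM ler_nat double_dp_le.
have : 1 <= #|F|%:R :> R.
  rewrite ler1n lt0n; apply: contraTneq F_large => ->.
  by rewrite mulr0 -ltNge.
move: dp_large dp_le F_large; set m := #|F|%:R => dp_large dp_le F_large m1.
have : 2 * m <= delta * m ^+ 2 by rewrite expr2 mulrA ler_pM2r ?(lt_le_trans ltr01).
lra.
Qed.

Lemma balanced_partition_of_card n k (S : 'I_k.+1 -> {set 'I_n}) :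
  pairwise_disjoint S -> \bigcup_i S i = setT ->
  (forall i, (k.+1 * #|S i|)%N = n) -> balanced_partition S.
Proof.
move=> Sdis Scov Scard; split=> //; split=> // i.
have -> : #|S i| = (n %/ k.+1)%N by rewrite -[X in (X %/ _)%N](Scard i) mulKn.
by rewrite leqnn leq_div2r // addnS subn1 leq_addr.
Qed.

Lemma card_setD_cube_series n k (S : 'I_k -> {set 'I_n}) (F : {set {set 'I_n}}) :
  #|F :\: cube_series S| = #|outside_cubes (val : member F -> _) S|.
Proof.
rewrite -[RHS](card_imset _ val_inj); apply: eq_card => A.
apply/setDP/imsetP => [[AF nA]|[[B BF] /[!inE] nB ->]].
  exists (exist _ A AF); rewrite // inE; apply: contra nA => /existsP[i Ai].
  by apply/bigcupP; exists i; rewrite ?powersetE.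
split=> //; apply: contra nB => /bigcupP[i _]; rewrite powersetE => Bi.
by apply/existsP; exists i.
Qed.

Lemma disjoint_pairs_stability (R : realType) (eps : R) k : 0 < eps -> (0 < k)%N ->
  exists2 eta : R, 0 < eta & exists n0, forall n, (n0 <= n)%N ->
  forall (F : {set {set 'I_n}}) (x : R), 0 < x -> x ^+ k.+1 = 2 ^+ n ->
    (1 - eta) * k.+1%:R * x <= #|F|%:R ->
    (1 - k.+1%:R^-1 - eta) * #|F|%:R ^+ 2 / 2 <= (dp F)%:R ->
  (k.+1 %| n)%N /\ exists S : 'I_k.+1 -> {set 'I_n},
    balanced_partition S /\ #|F :\: cube_series S|%:R <= eps * #|F|%:R.
Proof.
move=> eps0 k0; have [delta delta0 [n0 cover]] := exists_cube_cover eps0 k0.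
pose eta := Num.min (delta / 2) (1 / 2).
have eta0 : 0 < eta by rewrite lt_min !divr_gt0.
have eta_half : eta <= 1 / 2 by rewrite ge_min lexx orbT.
have eta_delta : eta <= delta / 2 by rewrite ge_min lexx.
pose B := Num.bound (2 / delta).
exists eta => //; exists (maxn n0 (B ^ k.+1)) => n; rewrite geq_max => /andP[n_n0 n_B].
move=> F x x0 xE F_large dp_large; pose f : member F -> {set 'I_n} := val.
have cardF : #|{: member F}| = #|F| by rewrite card_sig.
have F_ge_B : (B <= #|F|)%N.
  have := pow2_le_card_expn (T := 'I_n) (V := member F) k0 eta_half (ltW x0).
  rewrite card_ord cardF => /(_ xE F_large) pow2_le.
  rewrite -(@leq_exp2r _ _ k.+1) //; apply: leq_trans n_B _.
  by apply: leq_trans pow2_le; rewrite ltnW // ltn_expl.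
have delta_F : 2 <= delta * #|F|%:R.
  rewrite mulrC -ler_pdivrMr //; apply: le_trans (ltW (archi_boundP _)) _.
    by rewrite divr_ge0 // ltW.
  by rewrite ler_nat.
have [||||S [Sdis Scov Scard Sout]] := cover _ _ f x val_inj _ x0;
  rewrite ?card_ord ?cardF //.
- apply: le_trans F_large.
  rewrite ler_pM2r // ler_pM2r ?ltr0Sn // lerB //; lra.
- apply: arcs_ge_of_dp_ge delta_F _; apply: le_trans dp_large.
  by rewrite ler_pM2r ?invr_gt0 // ler_wpM2r ?exprn_ge0 // lerB.
rewrite !card_ord in Scard; rewrite cardF in Sout.
split; first by rewrite -(Scard ord0) dvdn_mulr.
exists S; split; first exact: balanced_partition_of_card.
by rewrite card_setD_cube_series.
Qed.

Local Close Scope ring_scope.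

(* Only here, because Reals rebinds the key %R and the notation ^ on nat. *)
From mathcomp Require Import Rstruct.
From Stdlib Require Import Reals.

Lemma Rpower_div_pow (a : R) n k : (0 < a)%R -> (0 < k)%N ->
  (Rpower a (INR n / INR k) ^ k = a ^ n)%R.
Proof.
move=> a0 k0; have kn0 : INR k <> 0%R by apply: not_0_INR; case: k k0.
rewrite -Rpower_pow; last exact: exp_pos.
rewrite Rpower_mult -Rpower_pow //.
by congr Rpower; rewrite /Rdiv Rmult_assoc Rinv_l // Rmult_1_r.
Qed.

Theorem theorem1p5 :
  forall (eps : R), (0 < eps)%R ->
  forall k : nat, (2 <= k)%N ->
  exists eta : R, (0 < eta)%R /\
  exists N : nat, forall n : nat, (N <= n)%N ->
  forall F : {set {set 'I_n}},
    (INR #|F| >= (1 - eta) * INR k * Rpower 2 (INR n / INR k))%R ->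
    (INR (dp F) >= (1 - 1 / INR k - eta) * (INR #|F| ^ 2) / 2)%R ->
    (k %| n)%N /\
    exists S : 'I_k -> {set 'I_n},
      balanced_partition S /\
      (INR #|F :\: cube_series S| <= eps * INR #|F|)%R.
Proof.
move=> eps eps0 [//|k] k0.
have [eta eta0 [n0 stab]] := disjoint_pairs_stability (introT RltP eps0) k0.
exists eta; split; first exact/RltP.
exists n0 => n /stab{}stab F m_large dp_large.
have x0 : (0 < Rpower 2 (INR n / INR k.+1))%R by exact: exp_pos.
have xE := Rpower_div_pow n Rlt_0_2 (ltn0Sn k).
have [||||divn [S [Sbal Sle]]] := stab F (Rpower 2 (INR n / INR k.+1)).
- exact/RltP.
- by rewrite -!RpowE xE.
- by apply/RleP; move: (Rge_le _ _ m_large); rewrite !INRE.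
- apply/RleP; move: (Rge_le _ _ dp_large).
  by rewrite !INRE RpowE /Rdiv Rmult_1_l.
split=> //; exists S; split=> //.
by rewrite !INRE; exact/RleP.
Qed.
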